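(* Suppose Assumptions 1, 2 and 3 (stated in the context) hold and $\|\vec L\|_1>0$. Fix an integer $K\ge 1$ and an initial point $x_0\in\mathbb{R}^d$. Run \textsc{signSGD} for $K$ iterations, i.e. for $k=0,\dots,K-1$ set $$x_{k+1}=x_k-\delta_k\,\mathrm{sign}(\tilde g_k),$$ where $\tilde g_k$ is a mini-batch stochastic gradient of size $n_k$ at $x_k$, with $$\delta_k=\frac{1}{\sqrt{\|\vec L\|_1 K}},\qquad n_k=K .$$ Let $N=K^2$ be the total number of stochastic gradient oracle calls. Then $$\left(\mathbb{E}\Big[\frac1K\sum_{k=0}^{K-1}\|g_k\|_1\Big]\right)^2\le \frac{1}{\sqrt N}\left[\sqrt{\|\vec L\|_1}\Big(f_0-f_*+\frac12\Big)+2\|\vec\sigma\|_1\right]^2 ,$$ where $g_k=\nabla f(x_k)$ and $f_0=f(x_0)$.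
   Context: $f:\mathbb{R}^d\to\mathbb{R}$ is differentiable with gradient $g(x)=\nabla f(x)$. Assumption 1: there is a constant $f_*$ with $f(x)\ge f_*$ for all $x$. Assumption 2: there is a vector $\vec L=(L_1,\dots,L_d)$ of non-negative constants such that for all $x,y$, $\big|f(y)-f(x)-g(x)^T(y-x)\big|\le \frac12\sum_{i=1}^d L_i(y_i-x_i)^2$. Assumption 3: upon query $x$, a stochastic gradient oracle returns a random vector $\tilde g(x)$, independent of all other oracle calls, with $\mathbb{E}[\tilde g(x)]=g(x)$ and $\mathbb{E}[(\tilde g(x)_i-g(x)_i)^2]\le\sigma_i^2$ for a vector $\vec\sigma=(\sigma_1,\dots,\sigma_d)$ of non-negative constants. A mini-batch stochastic gradient of size $n$ at $x$ is the average of $n$ independent oracle calls at $x$. $\mathrm{sign}$ acts componentwise, with $\mathrm{sign}(t)=1$ for $t>0$, $-1$ for $t<0$, $0$ for $t=0$. $\|\cdot\|_1$ is the $\ell_1$ norm. *)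

(* Defs.v *)
From HB Require Import structures.
From mathcomp Require Import all_boot all_order all_algebra.
From mathcomp Require Import all_classical all_reals all_analysis.
Set Implicit Arguments. Unset Strict Implicit. Unset Printing Implicit Defensive.
Import Order.TTheory GRing.Theory Num.Theory.
Import numFieldNormedType.Exports.
Local Open Scope classical_set_scope.
Local Open Scope ring_scope.

Definition l1norm {R : realType} {d : nat} (v : 'rV[R]_d) : R :=
  \sum_(i < d) `|v 0 i|.

Definition sign_vec {R : realType} {d : nat} (v : 'rV[R]_d) : 'rV[R]_d :=
  map_mx (fun t => Num.sg t) v.

Definition has_gradient {R : realType} {d : nat}
  (f : 'rV[R]_d -> R) (g : 'rV[R]_d -> 'rV[R]_d) : Prop :=
  forall x : 'rV[R]_d, differentiable f x /\
    forall v : 'rV[R]_d, 'd f x v = \sum_(i < d) g x 0 i * v 0 i.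

Definition coord_smooth {R : realType} {d : nat}
  (f : 'rV[R]_d -> R) (g : 'rV[R]_d -> 'rV[R]_d) (L : 'rV[R]_d) : Prop :=
  (forall i, 0 <= L 0 i) /\
  forall x y : 'rV[R]_d,
    `|f y - f x - \sum_(i < d) g x 0 i * (y 0 i - x 0 i)|
      <= 2^-1 * \sum_(i < d) L 0 i * (y 0 i - x 0 i) ^+ 2.

(* The oracle is G : R^d -> S -> R^d evaluated on a random seed; it is
   assumed jointly (Borel x S) measurable.  As there is no Borel
   sigma-algebra on 'rV[R]_d in the library, joint measurability is stated
   through composition with measurable random inputs (this is equivalent to
   measurability on the product sigma-algebra). *)
Definition oracle_measurable {R : realType} {d : nat} {dS : measure_display}
  {S : measurableType dS} (G : 'rV[R]_d -> S -> 'rV[R]_d) : Prop :=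
  forall (dT : measure_display) (T : measurableType dT)
         (X : T -> 'rV[R]_d) (Z : T -> S),
    (forall i, measurable_fun setT (fun w => X w 0 i)) ->
    measurable_fun setT Z ->
    forall i, measurable_fun setT (fun w => G (X w) (Z w) 0 i).

(* Mutual independence of the family of seeds xi k j (one seed per oracle
   call: call number j of iteration k): product rule on every finite
   subfamily of distinct indices. *)
Definition mutually_independent {R : realType} {dO : measure_display}
  {Omega : measurableType dO} (P : probability Omega R)
  {dS : measure_display} {S : measurableType dS}
  (xi : nat -> nat -> Omega -> S) : Prop :=
  forall (J : seq (nat * nat)) (A : nat * nat -> set S),
    uniq J -> (forall j, j \in J -> measurable (A j)) ->
    P (\big[setI/setT]_(j <- J) (xi j.1 j.2 @^-1` A j)) =
    (\prod_(j <- J) P (xi j.1 j.2 @^-1` A j))%E.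

Definition unbiased_bounded_variance {R : realType} {d : nat}
  {dO : measure_display} {Omega : measurableType dO} (P : probability Omega R)
  {dS : measure_display} {S : measurableType dS}
  (G : 'rV[R]_d -> S -> 'rV[R]_d) (xi : nat -> nat -> Omega -> S)
  (g : 'rV[R]_d -> 'rV[R]_d) (sigma : 'rV[R]_d) : Prop :=
  forall (k j : nat) (x : 'rV[R]_d) (i : 'I_d),
    P.-integrable setT (fun w => (G x (xi k j w) 0 i)%:E) /\
    (\int[P]_w (G x (xi k j w) 0 i)%:E = (g x 0 i)%:E)%E /\
    (\int[P]_w ((G x (xi k j w) 0 i - g x 0 i) ^+ 2)%:E
       <= (sigma 0 i ^+ 2)%:E)%E.

Fixpoint signSGD {R : realType} {d : nat} {dO : measure_display}
  {Omega : measurableType dO} {dS : measure_display} {S : measurableType dS}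
  (G : 'rV[R]_d -> S -> 'rV[R]_d) (xi : nat -> nat -> Omega -> S)
  (delta : nat -> R) (n : nat -> nat) (x0 : 'rV[R]_d) (k : nat)
  (w : Omega) : 'rV[R]_d :=
  match k with
  | 0 => x0
  | k'.+1 =>
      let x := signSGD G xi delta n x0 k' w in
      x - delta k' *: sign_vec ((n k')%:R^-1 *: \sum_(j < n k') G x (xi k' j w))
  end.

(* Main.v *)
Require Import Defs.
From HB Require Import structures.
From mathcomp Require Import all_boot all_order all_algebra.
From mathcomp Require Import all_classical all_reals all_analysis.
From mathcomp Require Import measurable_realfun ring lra.
Import Order.TTheory GRing.Theory Num.Theory.
Import numFieldNormedType.Exports.
Local Open Scope classical_set_scope.
Local Open Scope ring_scope.

(** The iterates take finitely many values, since every step adds one of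
    finitely many sign vectors; so conditioning on [x_k] is a finite sum over
    the events [x_k = x], which are independent of the seeds of iteration [k].

    For fixed [x], the minibatch has variance at most [sigma_i^2 / n_k], and a
    wrong sign in coordinate [i] forces an error of at least [|g_i(x)|]; hence
    [|g_i(x)| * P(wrong sign) <= sigma_i / sqrt n_k].  Coordinatewise
    smoothness gives, along every path,
      [f(x_{k+1}) <= f(x_k) - delta |g_k|_1 + 2 delta sum_i |g_{k,i}| 1(wrong sign)
                     + delta^2 |L|_1 / 2],
    and one sums over [k] and takes expectations. *)

(** * Independence carried from generating families of events to sigma-algebras *)

(** As functions of [A], the two sides are finite measures: [P] restricted to [B], and [P] scaled by
    [P B]. They agree on a family stable under intersection that contains [setT], hence on the
    sigma-algebra it generates. *)
Lemma g_sigma_algebra_indep_left {R : realType} {dO : measure_display}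
    {Omega : measurableType dO} (P : probability Omega R)
    (C : set_system Omega) (B : set Omega) :
    C `<=` measurable -> setI_closed C -> C setT -> measurable B ->
    (forall A, C A -> P (A `&` B) = (P A * P B)%E) ->
  forall A, <<s C >> A -> P (A `&` B) = (P A * P B)%E.
Proof.
move=> Cm CI CT mB PC A CA.
have PB0 : 0 <= fine (P B) by rewrite fine_ge0.
have PBE : P B = (fine (P B))%:E by rewrite fineK// fin_num_measure.
pose m1 : {measure set Omega -> \bar R} := mrestr P mB.
pose m2 : {measure set Omega -> \bar R} := mscale (NngNum PB0) P.
rewrite muleC.
have -> : (P B * P A)%E = m2 A by rewrite /m2 /= /mscale /= -PBE.
rewrite -[LHS]/(m1 A).
apply: (g_sigma_algebra_measure_unique C Cm (fun=> setT)) => //.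
- by rewrite bigcup_const//; exists 0%N.
- by move=> D CD; rewrite /m1 /m2 /= /mrestr /mscale /= -PBE muleC; exact: PC.
- move=> k; rewrite /m1 /= /mrestr setTI.
  by rewrite (le_lt_trans (probability_le1 P mB))// ltry.
Qed.

Lemma g_sigma_algebra_indep {R : realType} {dO : measure_display}
    {Omega : measurableType dO} (P : probability Omega R)
    (C1 C2 : set_system Omega) :
    C1 `<=` measurable -> setI_closed C1 -> C1 setT ->
    C2 `<=` measurable -> setI_closed C2 -> C2 setT ->
    (forall A B, C1 A -> C2 B -> P (A `&` B) = (P A * P B)%E) ->
  forall A B, <<s C1 >> A -> <<s C2 >> B -> P (A `&` B) = (P A * P B)%E.
Proof.
move=> C1m C1I C1T C2m C2I C2T PC A B sA sB.
have mA : measurable A.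
  exact: (smallest_sub (@sigma_algebra_measurable _ Omega) C1m).
rewrite setIC muleC; move: B sB.
apply: g_sigma_algebra_indep_left => // B C2B.
rewrite setIC muleC; move: A sA {mA}.
by apply: g_sigma_algebra_indep_left => // [|A C1A]; [exact: C2m|exact: PC].
Qed.

(** * Cylinder events and independence of disjoint groups of seeds *)

(** These rectangles are stable under intersection and generate the sigma-algebra of the variables
    [X j] with [j] in [J], so independence has to be checked on them alone. *)
Definition cylinder {I : choiceType} {T : Type} {dS : measure_display}
    {S : measurableType dS} (X : I -> T -> S) (J : seq I) : set_system T :=
  [set \bigcap_(j in [set` J]) (X j @^-1` A j) | A in
    [set A : I -> set S | forall j, measurable (A j)]].

Section cylinder_lemmas.
Context {I : choiceType} {T : Type} {dS : measure_display}
  {S : measurableType dS} (X : I -> T -> S).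

Lemma cylinder_setI_closed (J : seq I) : setI_closed (cylinder X J).
Proof.
move=> _ _ [A mA <-] [B mB <-].
exists (fun j => A j `&` B j) => [j|]; first exact: measurableI.
by rewrite -bigcapI; apply: eq_bigcapr => j _; rewrite preimage_setI.
Qed.

Lemma cylinder_setT (J : seq I) : cylinder X J setT.
Proof.
exists (fun=> setT) => //.
by rewrite -subTset => w _ j _.
Qed.

Lemma cylinder_preimage (J : seq I) (j : I) (A : set S) :
  j \in J -> measurable A -> cylinder X J (X j @^-1` A).
Proof.
move=> jJ mA; exists (fun i => if i == j then A else setT) => [i|].
  by case: ifP.
apply/seteqP; split => [w /(_ j jJ)/=|w Aw i _ /=]; first by rewrite eqxx.
by case: eqP => // ->.
Qed.

End cylinder_lemmas.

Lemma cylinder_measurable {I : choiceType} {dO : measure_display}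
    {Omega : measurableType dO} {dS : measure_display} {S : measurableType dS}
    (X : I -> Omega -> S) (J : seq I) :
  (forall j, measurable_fun setT (X j)) -> cylinder X J `<=` measurable.
Proof.
move=> mX _ [A mA <-]; apply: fin_bigcap_measurable => // j _.
by rewrite -[_ @^-1` _]setTI; exact: mX.
Qed.

Lemma measurable_fun_g_cylinder {I : choiceType} {T : pointedType}
    {dS : measure_display} {S : measurableType dS} (X : I -> T -> S)
    (J : seq I) (j : I) : j \in J ->
  measurable_fun setT (X j : g_sigma_algebraType (cylinder X J) -> S).
Proof.
move=> jJ _ A mA; rewrite setTI.
by apply: sub_sigma_algebra; exact: cylinder_preimage.
Qed.

Section independent_seeds.
Context {R : realType} {dO : measure_display} {Omega : measurableType dO}
  {P : probability Omega R} {dS : measure_display} {S : measurableType dS}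
  {xi : nat -> nat -> Omega -> S}.
Hypothesis mxi : forall k j, measurable_fun setT (xi k j).
Hypothesis indep : mutually_independent P xi.

Let X (p : nat * nat) := xi p.1 p.2.

(** The lists being disjoint, the sets [A] over [J1] and [B] over [J2] glue to one family [D] over
    [J1 ++ J2]; the product rule is used for [D], then for each list separately. *)
Lemma cylinder_indep (J1 J2 : seq (nat * nat)) : uniq (J1 ++ J2) ->
  forall A B, cylinder X J1 A -> cylinder X J2 B ->
    P (A `&` B) = (P A * P B)%E.
Proof.
move=> uJ _ _ [A mA <-] [B mB <-].
have /and3P[uJ1 J12 uJ2] : [&& uniq J1, ~~ has [in J1] J2 & uniq J2].
  by rewrite -cat_uniq.
pose D j := if j \in J1 then A j else B j.
have DA j : j \in J1 -> D j = A j by rewrite /D => ->.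
have DB j : j \in J2 -> D j = B j.
  by rewrite /D => jJ2; case: ifP => // jJ1; case/hasP: J12; exists j.
have mD j : j \in J1 ++ J2 -> measurable (D j).
  by move=> _; rewrite /D; case: ifP.
have bigD J C : (forall j, j \in J -> D j = C j) ->
    (\big[setI/setT]_(j <- J) (X j @^-1` D j) = \bigcap_(j in [set` J]) (X j @^-1` C j))
    * (\prod_(j <- J) P (X j @^-1` D j) = \prod_(j <- J) P (X j @^-1` C j))%E.
  by move=> DC; rewrite bigcap_seq; split; apply: eq_big_seq => j /DC ->.
have := indep (J1 ++ J2) D uJ mD.
rewrite !big_cat /= -/X !(bigD _ _ DA) !(bigD _ _ DB) !bigcap_seq => ->.
by rewrite !indep.
Qed.

Lemma indep_blocks (J1 J2 : seq (nat * nat)) : uniq (J1 ++ J2) ->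
  forall A B, <<s cylinder X J1 >> A -> <<s cylinder X J2 >> B ->
    P (A `&` B) = (P A * P B)%E.
Proof.
move=> uJ; apply: g_sigma_algebra_indep.
- by apply: cylinder_measurable => j; exact: mxi.
- exact: cylinder_setI_closed.
- exact: cylinder_setT.
- by apply: cylinder_measurable => j; exact: mxi.
- exact: cylinder_setI_closed.
- exact: cylinder_setT.
- exact: cylinder_indep.
Qed.

End independent_seeds.

(** * Second moments of sums of independent centred variables *)

Lemma integral_cst_probability {R : realType} {dO : measure_display}
    {Omega : measurableType dO} (P : probability Omega R) (r : R) :
  (\int[P]_w r%:E = r%:E)%E.
Proof.
rewrite -[LHS]/(\int[P]_w (cst r%:E w))%E integral_cst//=.
by rewrite probability_setT mule1.
Qed.

(** The joint law of [(Z1, Z2)] agrees with the product of the two laws on rectangles, hence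
    everywhere. Fubini then applies, and the inner integral at fixed [s] is [u s] times the mean of
    [v], which is zero. *)
Lemma integral_indep_prod0 {R : realType} {dO : measure_display}
    {Omega : measurableType dO} (P : probability Omega R)
    {d1 d2 : measure_display} {S1 : measurableType d1} {S2 : measurableType d2}
    (Z1 : Omega -> S1) (Z2 : Omega -> S2) (u : S1 -> R) (v : S2 -> R) :
    measurable_fun setT Z1 -> measurable_fun setT Z2 ->
    (forall A B, measurable A -> measurable B ->
      P (Z1 @^-1` A `&` Z2 @^-1` B) = (P (Z1 @^-1` A) * P (Z2 @^-1` B))%E) ->
    measurable_fun setT u -> measurable_fun setT v ->
    P.-integrable setT (fun w => (v (Z2 w))%:E) ->
    (\int[P]_w (v (Z2 w))%:E = 0)%E ->
    P.-integrable setT (fun w => (u (Z1 w) * v (Z2 w))%:E) ->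
  (\int[P]_w (u (Z1 w) * v (Z2 w))%:E = 0)%E.
Proof.
move=> mZ1 mZ2 indepZ mu mv iv v0 iuv.
pose X1 : {mfun Omega >-> S1} := HB.pack Z1 (isMeasurableFun.Build _ _ _ _ Z1 mZ1).
pose X2 : {mfun Omega >-> S2} := HB.pack Z2 (isMeasurableFun.Build _ _ _ _ Z2 mZ2).
have mX12 : measurable_fun setT (fun w => (Z1 w, Z2 w)).
  exact: measurable_fun_pair.
pose X12 : {mfun Omega >-> (S1 * S2)%type} :=
  HB.pack (fun w => (Z1 w, Z2 w)) (isMeasurableFun.Build _ _ _ _ _ mX12).
pose m1 : probability S1 R := distribution P X1.
pose m2 : probability S2 R := distribution P X2.
pose m12 : probability (S1 * S2)%type R := distribution P X12.
have m12E A : measurable A -> m12 A = (m1 \x m2)%E A.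
  move=> mA; apply/esym.
  by apply: (@product_measure_unique _ _ _ _ _ m1 m2 m12) => // B C; exact: indepZ.
pose h : (S1 * S2)%type -> \bar R := fun z => (u z.1 * v z.2)%:E.
have mh : measurable_fun setT h.
  apply/measurable_EFinP; apply: measurable_funM.
  - by apply: measurableT_comp => //; exact: measurable_fst.
  - by apply: measurableT_comp => //; exact: measurable_snd.
have ih12 : m12.-integrable setT h by exact: integrable_pushforward.
have ih : (m1 \x m2)%E.-integrable setT h.
  apply/integrableP; split => //.
  have [_] := integrableP _ _ _ ih12.
  rewrite (eq_measure_integral (m1 \x m2)%E)//.
  by move=> A mA _; rewrite -[RHS]m12E.
transitivity (\int[m12]_z h z)%E.
  by rewrite integral_distribution.
rewrite (eq_measure_integral (m1 \x m2)%E); last by move=> A mA _; rewrite -[RHS]m12E.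
rewrite -integral12_prod_meas1//; apply: integral0_eq => s _.
rewrite /fubini_F /h /=.
have mv' : measurable_fun setT (fun y => (v y)%:E) by exact/measurable_EFinP.
under eq_integral do rewrite EFinM.
rewrite integralZl//; last exact: integrable_pushforward.
by rewrite integral_distribution// [X in (_ * X)%E]v0 mule0.
Qed.

Lemma integrableM_sqr {R : realType} {dO : measure_display}
    {Omega : measurableType dO} (P : probability Omega R) (X Y : Omega -> R) :
    measurable_fun setT X -> measurable_fun setT Y ->
    P.-integrable setT (fun w => (X w ^+ 2)%:E) ->
    P.-integrable setT (fun w => (Y w ^+ 2)%:E) ->
  P.-integrable setT (fun w => (X w * Y w)%:E).
Proof.
move=> mX mY iX iY.
have iXY : P.-integrable setT (fun w => (X w ^+ 2)%:E + (Y w ^+ 2)%:E)%E.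
  exact: integrableD.
apply: le_integrable iXY => //.
  by apply/measurable_EFinP; exact: measurable_funM.
move=> w _; rewrite /= lee_fin.
rewrite [leRHS]ger0_norm ?addr_ge0 ?sqr_ge0//.
rewrite normrM -(real_normK (num_real (X w))) -(real_normK (num_real (Y w))).
have := sqr_ge0 (`|X w| - `|Y w|); have := normr_ge0 (X w).
have := normr_ge0 (Y w); nra.
Qed.

(** Expanding the square leaves the [n] diagonal terms, each at most [c]. The cross-term hypothesis
    may assume integrability, because it is derived here from the second moments; this matches the
    form of [integral_indep_prod0]. *)
Lemma integral_sqr_sum_uncorrelated {R : realType} {dO : measure_display}
    {Omega : measurableType dO} (P : probability Omega R) (n : nat) (c : R)
    (Y : 'I_n -> Omega -> R) :
    (forall j, measurable_fun setT (Y j)) ->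
    (forall j, \int[P]_w (Y j w ^+ 2)%:E <= c%:E)%E ->
    (forall j l, j != l -> P.-integrable setT (fun w => (Y j w * Y l w)%:E) ->
      (\int[P]_w (Y j w * Y l w)%:E = 0)%E) ->
  (\int[P]_w ((\sum_j Y j w) ^+ 2)%:E <= (n%:R * c)%:E)%E.
Proof.
move=> mY Yc Y0.
have iY2 j : P.-integrable setT (fun w => (Y j w ^+ 2)%:E).
  apply/integrableP; split.
    by apply/measurable_EFinP; exact: measurable_funX.
  under eq_integral do rewrite /= ger0_norm ?sqr_ge0//.
  by rewrite (le_lt_trans (Yc j)) ?ltry.
have iYY j l : P.-integrable setT (fun w => (Y j w * Y l w)%:E).
  exact: integrableM_sqr.
have -> : (fun w => ((\sum_j Y j w) ^+ 2)%:E) =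
    (fun w => \sum_j \sum_l (Y j w * Y l w)%:E)%E.
  apply/funext => w; rewrite expr2 mulr_suml -sumEFin.
  by apply: eq_bigr => j _; rewrite mulr_sumr -sumEFin.
rewrite integral_sum//; last by move=> j; exact: integrable_sum.
under eq_bigr => j _.
  rewrite integral_sum// (bigD1 j)//= big1 ?adde0; last first.
    by move=> l lj; rewrite Y0// eq_sym.
  over.
apply: (@le_trans _ _ (\sum_(j < n) c%:E)%E).
  by apply: lee_sum => j _; under eq_integral do rewrite -expr2.
by rewrite sumEFin sumr_const card_ord mulr_natl.
Qed.

(** * Conditioning on a variable with finitely many values *)

Lemma sum_finite_range {T : Type} {E : eqType} {R : pzRingType} (X : T -> E)
    (s : seq E) (F : E -> T -> R) : uniq s -> (forall w, X w \in s) ->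
  forall w, F (X w) w = \sum_(x <- s) F x w * \1_(X @^-1` [set x]) w.
Proof.
move=> us Xs w; rewrite (bigD1_seq (X w))//= big1 ?addr0.
  by rewrite indicE mem_set ?mulr1.
by move=> x xX; rewrite indicE memNset ?mulr0//= => /esym/eqP; exact/negP.
Qed.

(** Measurability is asked in [w] at each fixed [x], with no regularity in [x]; this is how [g] at
    the random iterates becomes measurable. *)
Lemma measurable_fun_finite_range {R : realType} {d : measure_display}
    {T : measurableType d} {E : eqType} (X : T -> E) (s : seq E)
    (F : E -> T -> R) :
    uniq s -> (forall w, X w \in s) ->
    (forall x, measurable (X @^-1` [set x])) ->
    (forall x, measurable_fun setT (F x)) ->
  measurable_fun setT (fun w => F (X w) w).
Proof.
move=> us Xs mX mF.
rewrite (_ : (fun w => _) =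
  (fun w => \sum_(x <- s) F x w * \1_(X @^-1` [set x]) w)); last first.
  by apply/funext => w; exact: (sum_finite_range X s F us Xs).
apply: measurable_sum => x; apply: measurable_funM => //.
Qed.

(** Total expectation: by independence the value [x] contributes [a x * P (B x)] weighted by the
    probability of [X = x], hence at most [c] times that weight, and the weights sum to 1. *)
Lemma integral_finite_range_indep_le {R : realType} {dO : measure_display}
    {Omega : measurableType dO} (P : probability Omega R) {E : eqType}
    (X : Omega -> E) (s : seq E) (B : E -> set Omega) (a : E -> R) (c : R) :
    uniq s -> (forall w, X w \in s) ->
    (forall x, measurable (X @^-1` [set x])) -> (forall x, measurable (B x)) ->
    (forall x, P (X @^-1` [set x] `&` B x) =
      (P (X @^-1` [set x]) * P (B x))%E) ->
    (forall x, 0 <= a x) -> (forall x, ((a x)%:E * P (B x) <= c%:E)%E) ->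
  (\int[P]_w (a (X w) * \1_(B (X w)) w)%:E <= c%:E)%E.
Proof.
move=> us Xs mX mB indepX a0 aBc.
(* Obtained by decomposing the constant function 1 along the values of [X] and integrating. *)
have sumP : (\sum_(x <- s) P (X @^-1` [set x]) = 1)%E.
  rewrite -(@probability_setT _ _ _ P) -[RHS]mul1e -integral_cst//.
  under [RHS]eq_integral => w _.
    rewrite /cst/= [X in X%:E](sum_finite_range X s (fun _ _ => 1) us Xs w).
    rewrite -sumEFin; over.
  rewrite ge0_integral_sum//.
  - apply: eq_bigr => x _; under eq_integral do rewrite mul1r.
    by rewrite integral_indic// setIT.
  - move=> x; apply/measurable_EFinP; apply: measurable_funM => //.
under eq_integral => w _.
  rewrite (sum_finite_range X s (fun x w => a x * \1_(B x) w) us Xs w) -sumEFin.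
  over.
rewrite /= ge0_integral_sum//; last 2 first.
- move=> x; apply/measurable_EFinP.
  by apply: measurable_funM; [apply: measurable_funM => //|]; exact: measurable_indic.
- by move=> x w _; rewrite lee_fin !mulr_ge0.
rewrite -[leRHS]mule1 -sumP ge0_sume_distrr//; apply: lee_sum => x _.
under eq_integral => w _.
  rewrite -mulrA -[_ * \1_ _ w]/((\1_(B x) \* \1_(X @^-1` [set x])) w) -indicI EFinM.
  over.
rewrite ge0_integralZl_EFin//; last first.
  by apply/measurable_EFinP; apply: measurable_indic; exact: measurableI.
rewrite integral_indic//; last exact: measurableI.
rewrite setIT setIC [X in (_ * X <= _)%E](indepX x) muleCA muleC.
exact: lee_wpmul2r.
Qed.

(** * Finite range and measurability of the iterates *)

Lemma measurable_sgr {R : realType} : measurable_fun setT (Num.sg : R -> R).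
Proof.
apply: nondecreasing_measurable => // x y xy.
case: (sgrP x) xy => [->|x0|x0] xy; case: (sgrP y) => // y0; lra.
Qed.

Section finitely_many_iterates.
Context {R : realType} {d : nat}.

Lemma sign_vec_finite : exists s : seq 'rV[R]_d, forall v, sign_vec v \in s.
Proof.
(* The booleans record whether a coordinate is positive and whether it is negative; the difference
   of their values is its sign. *)
pose V (t : {ffun 'I_d -> bool * bool}) : 'rV[R]_d :=
  \row_i ((t i).1%:R - (t i).2%:R).
exists [seq V t | t <- enum {ffun 'I_d -> bool * bool}].
move=> v; apply/mapP.
exists [ffun i => (0 < v 0 i, v 0 i < 0)]; first by rewrite mem_enum.
apply/rowP => i; rewrite !mxE ffunE /=.
by case: sgrP; rewrite ?subr0 ?sub0r ?subrr.
Qed.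

Context {dS : measure_display} {S : measurableType dS}
  (G : 'rV[R]_d -> S -> 'rV[R]_d).

(** The sample space is a bare type, so the same average can be read over [Omega] with a smaller
    sigma-algebra. *)
Definition minibatch {T : Type} (zeta : nat -> nat -> T -> S) (n : nat -> nat)
    (x : 'rV[R]_d) (k : nat) (w : T) : 'rV[R]_d :=
  (n k)%:R^-1 *: \sum_(j < n k) G x (zeta k j w).

Context {dT : measure_display} {T : measurableType dT}
  (zeta : nat -> nat -> T -> S) (delta : nat -> R) (n : nat -> nat)
  (x0 : 'rV[R]_d).

Lemma signSGD_finite (k : nat) : exists s : seq 'rV[R]_d,
  uniq s /\ forall w, signSGD G zeta delta n x0 k w \in s.
Proof.
elim: k => [|k [s [_ ks]]]; first by exists [:: x0]; split => // w; rewrite inE.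
have [sg sgP] := sign_vec_finite.
exists (undup [seq x - delta k *: v | x <- s, v <- sg]).
split=> [|w]; first exact: undup_uniq.
rewrite mem_undup; apply/allpairsP.
exists (signSGD G zeta delta n x0 k w,
  sign_vec (minibatch zeta n (signSGD G zeta delta n x0 k w) k w)).
by split; [exact: ks|exact: sgP|].
Qed.

Hypothesis mG : oracle_measurable G.

Lemma measurable_minibatch (X : T -> 'rV[R]_d) (k : nat) :
    (forall i, measurable_fun setT (fun w => X w 0 i)) ->
    (forall j, (j < n k)%N -> measurable_fun setT (zeta k j)) ->
  forall i, measurable_fun setT (fun w => minibatch zeta n (X w) k w 0 i).
Proof.
move=> mX mz i.
rewrite (_ : (fun w => _) = (fun w => (n k)%:R^-1 *
    \sum_(j < n k) G (X w) (zeta k j w) 0 i)).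
  apply: measurable_funM => //; apply: measurable_sum => j.
  by apply: mG => //; exact: mz.
by apply/funext => w; rewrite mxE summxE.
Qed.

(** Measurability is asked exactly of the seeds drawn before iteration [k]. Over the sigma-algebra
    generated by those seeds, the conclusion says that the iterate is a function of the past. *)
Lemma measurable_signSGD (k : nat) :
    (forall l j, (l < k)%N -> (j < n l)%N -> measurable_fun setT (zeta l j)) ->
  forall i, measurable_fun setT (fun w => signSGD G zeta delta n x0 k w 0 i).
Proof.
elim: k => [|k IH] mz i //=.
have mX := IH (fun l j lk => mz l j (ltnW lk)).
have mM := measurable_minibatch (signSGD G zeta delta n x0 k) k mX
  (fun j => mz k j (ltnSn k)) i.
rewrite (_ : (fun w => _) = (fun w => signSGD G zeta delta n x0 k w 0 i -
  delta k * Num.sg (minibatch zeta n (signSGD G zeta delta n x0 k w) k w 0 i))).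
  apply: measurable_funB => //; apply: measurable_funM => //.
  exact: (measurableT_comp measurable_sgr mM).
by apply/funext => w; rewrite !mxE.
Qed.

End finitely_many_iterates.

Lemma measurable_preimage_row {R : realType} {d : nat} {dT : measure_display}
    {T : measurableType dT} (X : T -> 'rV[R]_d) (x : 'rV[R]_d) :
    (forall i, measurable_fun setT (fun w => X w 0 i)) ->
  measurable (X @^-1` [set x]).
Proof.
move=> mX.
rewrite (_ : _ @^-1` _ =
  \bigcap_(i in [set: 'I_d]) ((fun w => X w 0 i) @^-1` [set x 0 i])).
  apply: fin_bigcap_measurable => // i _.
  by rewrite -[_ @^-1` _]setTI; exact: mX.
apply/seteqP; split => w Xw; first by move=> i _ /=; rewrite Xw.
by apply/rowP => i; exact: Xw.
Qed.

(** * Probability and expected cost of a wrong sign *)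

Section sign_errors.
Context {R : realType} {d : nat} {g : 'rV[R]_d -> 'rV[R]_d} {sigma : 'rV[R]_d}
  {dO : measure_display} {Omega : measurableType dO} {P : probability Omega R}
  {dS : measure_display} {S : measurableType dS}
  {G : 'rV[R]_d -> S -> 'rV[R]_d} {xi : nat -> nat -> Omega -> S}.
Hypotheses (sigma0 : forall i, 0 <= sigma 0 i) (mG : oracle_measurable G)
  (mxi : forall k j, measurable_fun setT (xi k j))
  (indep : mutually_independent P xi)
  (oracle : unbiased_bounded_variance P G xi g sigma).
Variable n : nat -> nat.

(** The error is the average of [n k] centred, pairwise independent terms [u (xi k j w)], so the
    second moments add up without cross terms. *)
Lemma minibatch_variance (k : nat) (x : 'rV[R]_d) (i : 'I_d) : (0 < n k)%N ->
  (\int[P]_w ((minibatch G xi n x k w 0 i - g x 0 i) ^+ 2)%:E <=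
    ((n k)%:R^-1 * sigma 0 i ^+ 2)%:E)%E.
Proof.
move=> n0.
have nR0 : (n k)%:R != 0 :> R by rewrite pnatr_eq0 -lt0n.
pose u s := G x s 0 i - g x 0 i.
have mu : measurable_fun setT u.
  apply: measurable_funB => //.
  (* Oracle measurability is used over the seed space itself, with a constant query and the identity
     as seed. *)
  exact: (mG dS S (fun=> x) id).
have mY j : measurable_fun setT (fun w => u (xi k j w)).
  exact: (measurableT_comp mu (mxi k j)).
pose Y (j : 'I_(n k)) w := u (xi k j w).
have -> : (fun w => ((minibatch G xi n x k w 0 i - g x 0 i) ^+ 2)%:E) =
    (fun w => ((n k)%:R ^- 2)%:E * ((\sum_j Y j w) ^+ 2)%:E)%E.
  apply/funext => w; rewrite -EFinM; congr EFin.
  rewrite /Y /u big_split/= sumr_const card_ord mxE summxE -exprVn -exprMn.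
  by congr (_ ^+ 2); rewrite -mulr_natl; field.
rewrite ge0_integralZl_EFin//; first last.
- apply/measurable_EFinP; apply: measurable_funX.
  by apply: measurable_sum => j; exact: mY.
- by move=> w _; rewrite lee_fin sqr_ge0.
apply: (@le_trans _ _ (((n k)%:R ^- 2)%:E * ((n k)%:R * sigma 0 i ^+ 2)%:E)%E).
  apply: lee_wpmul2l; first by rewrite lee_fin invr_ge0 exprn_ge0.
  apply: integral_sqr_sum_uncorrelated => [j|j|j l jl iYY].
  - exact: mY.
  - by have [_ []] := oracle k j x i.
  - apply: (integral_indep_prod0 P (xi k j) (xi k l) u u) iYY => //.
    + move=> A B mA mB.
      have kjl : (k, val j) != (k, val l) by rewrite xpair_eqE eqxx.
      have := indep [:: (k, val j); (k, val l)]
        (fun p => if p == (k, val j) then A else B).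
      rewrite !big_cons !big_nil /= eqxx eq_sym (negbTE kjl) setIT mule1.
      apply; first by rewrite inE kjl.
      by move=> p _; case: ifP.
    + have [iG _] := oracle k l x i.
      rewrite (_ : (fun w => _) =
        (fun w => (G x (xi k l w) 0 i)%:E - (g x 0 i)%:E)%E)//.
      by apply: integrableB => //; exact: finite_measure_integrable_cst.
    + have [iG [EG _]] := oracle k l x i.
      under eq_integral do rewrite EFinB.
      rewrite integralB//; last exact: finite_measure_integrable_cst.
      by rewrite EG integral_cst_probability subee.
by rewrite -EFinM lee_fin le_eqVlt; apply/orP; left; apply/eqP; field.
Qed.

(** Signs are three-valued: a zero facing a nonzero value is an error too. When [g x 0 i] is the
    zero, the weight [|g x 0 i|] put on the event later cancels it. *)
Definition sign_error (x : 'rV[R]_d) (k : nat) (i : 'I_d) : set Omega :=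
  [set w | Num.sg (minibatch G xi n x k w 0 i) != Num.sg (g x 0 i)].

Definition block (k : nat) : seq (nat * nat) :=
  [seq (k, j) | j <- iota 0 (n k)].

Definition past (k : nat) : seq (nat * nat) :=
  [seq (l, j) | l <- iota 0 k, j <- iota 0 (n l)].

Lemma uniq_past_block (k : nat) : uniq (past k ++ block k).
Proof.
rewrite cat_uniq; apply/and3P; split.
- apply: allpairs_uniq_dep => [|l _|]; [exact: iota_uniq|exact: iota_uniq|].
  by move=> [a b] [c e] _ _ /= [-> ->].
- apply/hasPn => _ /mapP[j _ ->]; apply/allpairsPdep => -[l [b [lk _ [kl _]]]].
  by move: lk; rewrite -kl mem_iota ltnn andbF.
- by rewrite map_inj_uniq ?iota_uniq// => a b [].
Qed.

Let X (p : nat * nat) := xi p.1 p.2.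

(** [Omega] is re-equipped with the sigma-algebra generated by the seeds of the block. These are
    measurable there by construction, so the general measurability of [minibatch] places the event
    in that sigma-algebra. *)
Lemma sign_error_block (k : nat) (x : 'rV[R]_d) (i : 'I_d) :
  <<s cylinder X (block k) >> (sign_error x k i).
Proof.
pose T : measurableType _ := g_sigma_algebraType (cylinder X (block k)).
have mM : measurable_fun setT (fun w : T => minibatch G xi n x k w 0 i).
  apply: (@measurable_minibatch R d _ S G _ T xi n mG (fun=> x) k) => // j jn.
  apply: (measurable_fun_g_cylinder X (block k) (k, j)).
  by apply: map_f; rewrite mem_iota.
have := measurableT_comp measurable_sgr mM.
move=> /(_ measurableT [set~ Num.sg (g x 0 i)]).
rewrite setTI (_ : _ @^-1` _ = sign_error x k i); last first.
  by apply/seteqP; split => w /= /eqP.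
by apply; exact: measurableC.
Qed.

Lemma signSGD_past (delta : nat -> R) (x0 : 'rV[R]_d) (k : nat) (x : 'rV[R]_d) :
  <<s cylinder X (past k) >> (signSGD G xi delta n x0 k @^-1` [set x]).
Proof.
pose T : measurableType _ := g_sigma_algebraType (cylinder X (past k)).
(* [signSGD] carries the measurable structure of its sample space as an
   argument, so its instances over [Omega] and [T] do not match syntactically. *)
have signSGDE l w :
    signSGD G xi delta n x0 l w = @signSGD R d _ T _ _ G xi delta n x0 l w.
  by elim: l => //= l ->.
suff : measurable ((@signSGD R d _ T _ _ G xi delta n x0 k) @^-1` [set x]).
  by congr (measurable _); apply/seteqP; split => w /=; rewrite signSGDE.
apply: measurable_preimage_row; apply: measurable_signSGD => // l j lk jn.
apply: (measurable_fun_g_cylinder X (past k) (l, j)).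
by apply/allpairsPdep; exists l, j; rewrite !mem_iota.
Qed.

Lemma g_cylinder_measurable (J : seq (nat * nat)) (A : set Omega) :
  <<s cylinder X J >> A -> measurable A.
Proof.
move: A; apply: (smallest_sub (@sigma_algebra_measurable _ Omega)).
by apply: cylinder_measurable => j; exact: mxi.
Qed.

Lemma sign_error_probability (k : nat) (x : 'rV[R]_d) (i : 'I_d) :
    (0 < n k)%N ->
  (`|g x 0 i|%:E * P (sign_error x k i) <=
    (sigma 0 i / Num.sqrt (n k)%:R)%:E)%E.
Proof.
move=> n0.
have mB : measurable (sign_error x k i).
  exact: g_cylinder_measurable (sign_error_block k x i).
have p01 := probability_le1 P mB.
have [p PE] : exists p, P (sign_error x k i) = p%:E.
  by exists (fine (P (sign_error x k i))); rewrite fineK// fin_num_measure.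
have p0 : 0 <= p by rewrite -lee_fin -PE.
move: p01; rewrite PE !lee_fin => p1.
(* Since [p <= 1], it suffices to bound [g_i^2 p], which avoids Jensen. *)
have : ((g x 0 i ^+ 2 * p)%:E <= ((n k)%:R^-1 * sigma 0 i ^+ 2)%:E)%E.
  apply: le_trans (minibatch_variance k x i n0).
  rewrite EFinM -PE -[sign_error _ _ _]setIT -integral_indic//.
  rewrite -ge0_integralZl_EFin ?sqr_ge0//; last first.
    by apply/measurable_EFinP; exact: measurable_indic.
  apply: ge0_le_integral => //.
  - by move=> w _; rewrite mule_ge0// lee_fin sqr_ge0.
  - apply/measurable_EFinP; apply: measurable_funM => //.
  - apply/measurable_EFinP; apply: measurable_funX; apply: measurable_funB => //.
    by apply: (measurable_minibatch G xi n mG (fun=> x)) => *; [exact: measurable_cst|exact: mxi].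
  - move=> w _; rewrite -EFinM lee_fin indicE.
    have [|_] := boolP (w \in sign_error x k i); last by rewrite mulr0 sqr_ge0.
    rewrite inE /sign_error/= mulr1 => ab.
    (* When the signs differ, either one of the two values is zero or they lie on opposite sides of
       zero; their distance is then at least [|g x 0 i|]. *)
    by move: ab; case: sgrP => [->|a0|a0]; case: sgrP => [->|b0|b0]; rewrite ?eqxx// => _; nra.
rewrite lee_fin => gp.
(* Both sides are non-negative, so it suffices to compare their squares. *)
rewrite -(@ler_pXn2r _ 2)// ?nnegrE ?mulr_ge0// ?divr_ge0// ?sqrtr_ge0//.
rewrite expr_div_n sqr_sqrtr// mulrC exprMn.
rewrite real_normK ?num_real//.
rewrite [leRHS]mulrC; apply: le_trans gp.
by rewrite mulrC ler_wpM2l ?sqr_ge0// expr2 ler_piMl.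
Qed.

(** The iterate is determined by [past k] and the error at a fixed point by [block k]; these index
    lists are disjoint, so the bound at a fixed point survives at the random one. *)
Lemma expected_sign_error (delta : nat -> R) (x0 : 'rV[R]_d) (k : nat)
    (i : 'I_d) : (0 < n k)%N ->
  (\int[P]_w (`|g (signSGD G xi delta n x0 k w) 0 i| *
     \1_(sign_error (signSGD G xi delta n x0 k w) k i) w)%:E <=
    (sigma 0 i / Num.sqrt (n k)%:R)%:E)%E.
Proof.
move=> n0; have [s [us ks]] := signSGD_finite G xi delta n x0 k.
apply: (integral_finite_range_indep_le P (signSGD G xi delta n x0 k) s
  (fun x => sign_error x k i) (fun x => `|g x 0 i|)) => // x.
- exact: g_cylinder_measurable (signSGD_past delta x0 k x).
- exact: g_cylinder_measurable (sign_error_block k x i).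
- apply: (indep_blocks mxi indep (past k) (block k)).
  + exact: uniq_past_block.
  + exact: signSGD_past.
  + exact: sign_error_block.
- exact: sign_error_probability.
Qed.

End sign_errors.

(** * Deterministic descent along one path *)

Lemma signSGD_step_descent {R : realType} {d : nat} (f : 'rV[R]_d -> R)
    (g : 'rV[R]_d -> 'rV[R]_d) (L x v : 'rV[R]_d) (delta : R) :
    coord_smooth f g L -> 0 <= delta ->
  f (x - delta *: sign_vec v) <= f x - delta * l1norm (g x) +
    2 * delta * (\sum_i `|g x 0 i| * (Num.sg (v 0 i) != Num.sg (g x 0 i))%:R) +
    2^-1 * delta ^+ 2 * l1norm L.
Proof.
move=> [L0 smooth] delta0; set y := x - _.
have yx i : y 0 i - x 0 i = - (delta * Num.sg (v 0 i)).
  by rewrite !mxE addrAC subrr add0r.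
have := smooth x y; rewrite ler_norml => /andP[_].
rewrite -addrA -opprD lerBlDr => /le_trans; apply.
rewrite addrC -!addrA lerD2l addrA; apply: lerD.
  rewrite /l1norm !mulr_sumr -sumrN -big_split/=; apply: ler_sum => i _.
  (* The linear term is [- delta * |g x 0 i|] when the signs agree and at most [delta * |g x 0 i|]
     otherwise; the gap accounts for the factor 2. *)
  rewrite yx; case: (sgrP (g x 0 i)) => g0; case: (sgrP (v 0 i)) => _;
    case: eqP => /= sgE; rewrite ?g0; nra.
(* For the quadratic term, each coordinate moves by at most [delta], since a squared sign is at most
   1. *)
rewrite -mulrA ler_wpM2l// /l1norm mulr_sumr; apply: ler_sum => i _.
rewrite yx sqrrN exprMn (ger0_norm (L0 i)) mulrC ler_wpM2r//.
by rewrite ler_piMr ?sqr_ge0//; case: sgrP => _; rewrite ?sqrrN ?expr1n ?expr0n.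
Qed.

(** Induction on [K]: the values of [f] in the descent inequality telescope, and the constant step
    size factors out of the sums. *)
Lemma signSGD_pathwise_bound {R : realType} {d : nat} (f : 'rV[R]_d -> R)
    (g : 'rV[R]_d -> 'rV[R]_d) (L : 'rV[R]_d)
    {dO : measure_display} {Omega : measurableType dO}
    {dS : measure_display} {S : measurableType dS}
    (G : 'rV[R]_d -> S -> 'rV[R]_d) (xi : nat -> nat -> Omega -> S)
    (delta : R) (n : nat -> nat) (x0 : 'rV[R]_d) (K : nat) (w : Omega) :
  let x k := signSGD G xi (fun=> delta) n x0 k w in
  coord_smooth f g L -> 0 <= delta ->
  delta * (\sum_(k < K) l1norm (g (x k))) <= f x0 - f (x K) +
    2 * delta * (\sum_(k < K) \sum_i
      `|g (x k) 0 i| * \1_(@sign_error _ _ g _ _ _ _ G xi n (x k) k i) w) +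
    K%:R * (2^-1 * delta ^+ 2 * l1norm L).
Proof.
move=> x smooth delta0; elim: K => [|K IH].
  by rewrite !big_ord0 /= !mulr0 mul0r subrr !addr0.
rewrite !big_ord_recr/= -[K.+1%:R]natr1.
have := signSGD_step_descent f g L (x K) (minibatch G xi n (x K) K w) delta
  smooth delta0.
rewrite -[f (x K - _)]/(f (x K.+1)).
rewrite (eq_bigr (fun i => `|g (x K) 0 i| *
  \1_(@sign_error _ _ g _ _ _ _ G xi n (x K) K i) w)); last first.
  by move=> i _; rewrite indicE /sign_error mem_setE.
move: IH; lra.
Qed.

(** * Expectation of the summed bound for the chosen step and batch sizes *)

Theorem theorem1 (R : realType) (d : nat)
  (f : 'rV[R]_d -> R) (g : 'rV[R]_d -> 'rV[R]_d)
  (f_star : R) (L sigma : 'rV[R]_d)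
  (dO : measure_display) (Omega : measurableType dO) (P : probability Omega R)
  (dS : measure_display) (S : measurableType dS)
  (G : 'rV[R]_d -> S -> 'rV[R]_d) (xi : nat -> nat -> Omega -> S)
  (K : nat) (x0 : 'rV[R]_d) :
  has_gradient f g ->
  (forall x, f_star <= f x) ->
  coord_smooth f g L ->
  (forall i, 0 <= sigma 0 i) ->
  oracle_measurable G ->
  (forall k j, measurable_fun setT (xi k j)) ->
  mutually_independent P xi ->
  unbiased_bounded_variance P G xi g sigma ->
  0 < l1norm L ->
  (1 <= K)%N ->
  let delta := fun _ : nat => (Num.sqrt (l1norm L * K%:R))^-1 in
  let n := fun _ : nat => K in
  let N := (K ^ 2)%N in
  let E := (\int[P]_w
              ((K%:R)^-1 * \sum_(k < K) l1norm (g (signSGD G xi delta n x0 k w)))%:E)%E in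
  (E * E <=
   ((Num.sqrt N%:R)^-1 *
    (Num.sqrt (l1norm L) * (f x0 - f_star + 2^-1) + 2 * l1norm sigma) ^+ 2)%:E)%E.
Proof.
move=> _ f_ge smooth sigma0 mG mxi indep oracle Lpos K1.
pose delta (_ : nat) := (Num.sqrt (l1norm L * K%:R))^-1.
pose n (_ : nat) := K; pose x := signSGD G xi delta n x0.
pose E := (\int[P]_w (K%:R^-1 * \sum_(k < K) l1norm (g (x k w)))%:E)%E.
(* The [2^-1] is the total of the [K] quadratic terms, because [delta ^+ 2] is the inverse of
   [l1norm L * K%:R]. *)
pose D := f x0 - f_star + 2^-1.
change (E * E <= ((Num.sqrt (K ^ 2)%:R)^-1 *
  (Num.sqrt (l1norm L) * D + 2 * l1norm sigma) ^+ 2)%:E)%E.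
have KR : 0 < K%:R :> R by rewrite ltr0n.
have n0 k : (0 < n k)%N by [].
pose Y k i w := `|g (x k w) 0 i| *
  \1_(@sign_error _ _ g _ _ _ _ G xi n (x k w) k i) w.
have D0 : 0 <= D by have := f_ge x0; rewrite /D; lra.
have sK : 0 < Num.sqrt K%:R :> R by rewrite sqrtr_gt0.
have sL : 0 < Num.sqrt (l1norm L) by rewrite sqrtr_gt0.
have sKE : K%:R = Num.sqrt K%:R ^+ 2 :> R by rewrite sqr_sqrtr// ltW.
have sLE : l1norm L = Num.sqrt (l1norm L) ^+ 2 by rewrite sqr_sqrtr// ltW.
have deltaE : delta 0%N = (Num.sqrt (l1norm L) * Num.sqrt K%:R)^-1.
  by rewrite /delta sqrtrM// ltW.
have delta0 : 0 < delta 0%N by rewrite deltaE invr_gt0 mulr_gt0.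
(* The summed bound is divided by [K * delta], whose inverse is
   [Num.sqrt (l1norm L) / Num.sqrt K%:R]. *)
have pathwise w : K%:R^-1 * \sum_(k < K) l1norm (g (x k w)) <=
    Num.sqrt (l1norm L) / Num.sqrt K%:R * D +
    2 / K%:R * \sum_(k < K) \sum_i Y k i w.
  have : delta 0%N * (\sum_(k < K) l1norm (g (x k w))) <= f x0 - f (x K w) +
      2 * delta 0%N * (\sum_(k < K) \sum_i Y k i w) +
      K%:R * (2^-1 * delta 0%N ^+ 2 * l1norm L).
    exact: signSGD_pathwise_bound smooth (ltW delta0).
  have := f_ge (x K w).
  set A := \sum_(k < K) l1norm (g (x k w)).
  set B := \sum_(k < K) \sum_i Y k i w => fK dA.
  have dA' : delta 0%N * A <= D + 2 * delta 0%N * B.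
    apply: le_trans dA _; rewrite /D.
    suff -> : K%:R * (2^-1 * delta 0%N ^+ 2 * l1norm L) = 2^-1 by lra.
    by rewrite [in LHS]sLE [in LHS]sKE deltaE; field; rewrite !gt_eqF.
  have AD : A <= (D + 2 * delta 0%N * B) / delta 0%N.
    by rewrite ler_pdivlMr// mulrC.
  apply: le_trans (ler_wpM2l _ AD) _; first by rewrite invr_ge0 ltW.
  rewrite le_eqVlt; apply/orP; left; apply/eqP.
  by rewrite [in LHS]sKE [X in _ = _ + 2 / X * _]sKE deltaE; field; rewrite !gt_eqF.
have mX k y : measurable (x k @^-1` [set y]).
  exact: (g_cylinder_measurable mxi _ _ (signSGD_past mG n delta x0 k y)).
have mY k i : measurable_fun setT (Y k i).
  have [s [us ks]] := signSGD_finite G xi delta n x0 k.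
  apply: (measurable_fun_finite_range (x k) s (fun y w => `|g y 0 i| *
    \1_(@sign_error _ _ g _ _ _ _ G xi n y k i) w) us ks) => // y.
  apply: measurable_funM => //; apply: measurable_indic.
  exact: (g_cylinder_measurable mxi _ _ (sign_error_block mG n k y i)).
have ml1 k : measurable_fun setT (fun w => l1norm (g (x k w))).
  have [s [us ks]] := signSGD_finite G xi delta n x0 k.
  exact: (measurable_fun_finite_range (x k) s (fun y _ => l1norm (g y)) us ks).
have Y0 k i w : 0 <= Y k i w by rewrite mulr_ge0.
have l10 v : 0 <= @l1norm R d v by exact: sumr_ge0.
have mYs : measurable_fun setT (fun w => \sum_(k < K) \sum_i Y k i w).
  by apply: measurable_sum => k; apply: measurable_sum => i.
have Ys0 w : 0 <= \sum_(k < K) \sum_i Y k i w.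
  by apply: sumr_ge0 => k _; apply: sumr_ge0.
have E0 : (0 <= E)%E.
  apply: integral_ge0 => w _; rewrite lee_fin mulr_ge0 ?invr_ge0 ?ler0n//.
  by apply: sumr_ge0.
pose C := Num.sqrt (l1norm L) * D + 2 * l1norm sigma.
(* With batches of size [K], coordinate [i] costs at most [sigma 0 i / Num.sqrt K%:R] in each of the
   [K] iterations. *)
have sumY : (\int[P]_w (\sum_(k < K) \sum_i Y k i w)%:E <=
    (K%:R * (l1norm sigma / Num.sqrt K%:R))%:E)%E.
  under eq_integral do rewrite -sumEFin.
  rewrite ge0_integral_sum//; last 2 first.
  - by move=> k; apply/measurable_EFinP; apply: measurable_sum => i.
  - by move=> k w _; rewrite lee_fin sumr_ge0.
  rewrite (_ : K%:R * _ = \sum_(k < K) (l1norm sigma / Num.sqrt K%:R)); last first.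
    by rewrite sumr_const card_ord mulr_natl.
  rewrite -sumEFin.
  apply: lee_sum => k _.
  under eq_integral do rewrite -sumEFin.
  rewrite ge0_integral_sum//; last 2 first.
  - by move=> i; apply/measurable_EFinP.
  - by move=> i w _; rewrite lee_fin.
  rewrite /l1norm mulr_suml -sumEFin; apply: lee_sum => i _.
  rewrite (ger0_norm (sigma0 i)).
  exact: (expected_sign_error sigma0 mG mxi indep oracle n delta x0 k i).
(* After integration the noise term is [2 / K] times the bound of [sumY], so it decays like
   [1 / Num.sqrt K%:R], as the optimization term does. *)
have EC : (E <= (C / Num.sqrt K%:R)%:E)%E.
  apply: (@le_trans _ _ (\int[P]_w
    ((Num.sqrt (l1norm L) / Num.sqrt K%:R * D)%:E +
    (2 / K%:R)%:E * (\sum_(k < K) \sum_i Y k i w)%:E)))%E.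
    apply: ge0_le_integral => //.
    - move=> w _; rewrite lee_fin mulr_ge0 ?invr_ge0 ?ler0n//.
      by apply: sumr_ge0.
    - apply/measurable_EFinP; apply: measurable_funM => //.
      by apply: measurable_sum.
    - apply/measurable_EFinP; apply: measurable_funD => //.
      exact: measurable_funM.
    - by move=> w _; rewrite -EFinM -EFinD lee_fin.
  rewrite ge0_integralD//; first last.
  - by apply/measurable_EFinP; apply: measurable_funM.
  - by move=> w _; rewrite lee_fin mulr_ge0// divr_ge0.
  - by move=> w _; rewrite lee_fin mulr_ge0// divr_ge0// ltW.
  rewrite integral_cst_probability.
  rewrite ge0_integralZl_EFin//; last 2 first.
  - by move=> w _; rewrite lee_fin.
  - exact/measurable_EFinP.
  apply: (@le_trans _ _ ((Num.sqrt (l1norm L) / Num.sqrt K%:R * D)%:E +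
    (2 / K%:R)%:E * (K%:R * (l1norm sigma / Num.sqrt K%:R))%:E)%E).
    by rewrite leeD2l// lee_wpmul2l// lee_fin divr_ge0.
  rewrite -EFinM -EFinD lee_fin le_eqVlt; apply/orP; left; apply/eqP.
  by rewrite /C; field; rewrite !gt_eqF.
(* Squaring preserves the bound because [E] is non-negative; the resulting [1 / K] is the inverse
   square root of [K ^ 2]. *)
apply: (@le_trans _ _ ((C / Num.sqrt K%:R)%:E * (C / Num.sqrt K%:R)%:E)%E).
  exact: lee_pmul.
rewrite -EFinM lee_fin le_eqVlt; apply/orP; left; apply/eqP.
rewrite natrX sqrtr_sqr ger0_norm// -/C [in RHS]sKE.
by field; rewrite gt_eqF.
Qed.
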